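(* Let $z_1,\ldots,z_n$ be not necessarily distinct complex numbers with positive imaginary parts. Then there exists a unique $n\times n$ tri-diagonal matrix $$J=\begin{pmatrix} b_1 & a_1 & 0 & \cdots & 0\\ a_1 & b_2 & a_2 & \ddots & \vdots\\ 0 & a_2 & b_3 & \ddots & 0\\ \vdots & \ddots & \ddots & \ddots & a_{n-1}\\ 0 & \cdots & 0 & a_{n-1} & b_n\end{pmatrix}$$ with $\operatorname{Im} b_1>0$, $b_k\in\mathbb{R}$ for $k=2,\ldots,n$, and $a_k>0$ for $k=1,\ldots,n-1$, whose eigenvalues counted with algebraic multiplicity coincide with $\{z_k\}_{k=1}^n$.
   Context: No special definitions are needed beyond the claim. *)

(* Defs.v *)
From mathcomp Require Import all_boot all_order all_algebra.
From mathcomp Require Import reals complex.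

Set Implicit Arguments.
Unset Strict Implicit.
Unset Printing Implicit Defensive.

Import Order.TTheory GRing.Theory Num.Theory.
Local Open Scope ring_scope.

(* In R[i] the order relation [0 < x] means that x is real and positive; hence
   the condition on [J i j] with j = i + 1 says that the off-diagonal entries
   a_k are positive reals.  Indices start at 0: the entry b_1 is [J 0 0]. *)
Definition jacobi_form (R : realType) (n : nat) (J : 'M[R[i]]_n) : Prop :=
  [/\ forall i j : 'I_n, ((i.+1 < j) || (j.+1 < i))%N -> J i j = 0,
      forall i j : 'I_n, j = i.+1 :> nat -> 0 < J i j /\ J j i = J i j,
      forall i : 'I_n, i = 0%N :> nat -> 0 < complex.Im (J i i) &
      forall i : 'I_n, (0 < i)%N -> complex.Im (J i i) = 0].

Definition alg_mult (F : fieldType) (n : nat) (A : 'M[F]_n) (x : F) : nat :=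
  mup x (char_poly A).

(* Main.v *)
(* Expanding along the first row, the characteristic polynomials P, q, r of a
   Jacobi matrix and of its two lower-right truncations satisfy
   P = ('X - b_1) q - a_1^2 r. Hence a real Jacobi matrix is determined by
   (P, q), and for J with Im b_1 = g > 0 the characteristic polynomial is
   p = P - i g q, from which P, g and q are recovered by comparison with the
   conjugate polynomial p*; this gives uniqueness.
   For existence, start from p = \prod_k ('X - z_k). The Hermite form
   (p(x) p*(y) - p*(x) p(y)) / (2i (x - y)) is positive definite because all
   the z_k have positive imaginary part, and it is g times the Bezoutian
   B(P, q) = (P(x) q(y) - q(x) P(y)) / (x - y). Positivity passes through
   Euclid's algorithm: if P = ('X - b) q - c r, then
   B(P, q) = q(x) q(y) + c B(q, r), so c B(q, r) is positive definite (restrict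
   B(P, q) to the kernel of q), and c > 0 since c is one of its diagonal
   entries. *)
Require Import Defs.
From mathcomp Require Import all_boot all_order all_algebra.
From mathcomp Require Import reals complex.
From mathcomp Require Import ring zify.

Set Implicit Arguments.
Unset Strict Implicit.
Unset Printing Implicit Defensive.

Import Order.TTheory GRing.Theory Num.Theory.
Local Open Scope ring_scope.

(** * Tridiagonal determinants and recovery of a Jacobi matrix from two polynomials *)

(** Expand along the first row; the minor of the entry next to the corner is then expanded along its
    first column, where a single entry survives. *)
Lemma det_tridiag (A : comPzRingType) (n : nat) (M : 'M[A]_n.+2) :
    (forall j : 'I_n.+2, (1 < j)%N -> M 0 j = 0) ->
    (forall i : 'I_n.+2, (1 < i)%N -> M i 0 = 0) ->
  \det M = M 0 0 * \det (row' 0 (col' 0 M))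
    - M 0 (lift 0 0) * M (lift 0 0) 0
      * \det (row' 0 (col' 0 (row' 0 (col' 0 M)))).
Proof.
move=> M0 Mc; rewrite (expand_det_row _ 0) !big_ord_recl big1 ?addr0; last first.
  by move=> i _; rewrite M0 // mul0r.
congr (_ * _ + _); first by rewrite /cofactor expr0 mul1r.
rewrite /cofactor expr1 mulN1r mulrN -mulrA; congr (- (_ * _)).
rewrite (expand_det_col _ 0) big_ord_recl big1 ?addr0; last first.
  by move=> i _; rewrite !mxE (_ : lift (lift 0 0) 0 = 0) ?Mc ?mul0r //; apply/val_inj.
rewrite !mxE (_ : lift (lift 0 0) 0 = 0); last exact/val_inj.
congr (_ * _); rewrite /cofactor expr0 mul1r; congr (\det _).
apply/matrixP => i j; rewrite !mxE; congr (M _ _); exact/val_inj.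
Qed.

(** Sequences over all of [nat] make deletion of the first row and column a mere [shift]. *)
Definition jac (A : pzRingType) (n : nat) (a b : nat -> A) : 'M[A]_n :=
  \matrix_(i < n, j < n)
    if j == i then b i else
    if j == i.+1 :> nat then a i else
    if i == j.+1 :> nat then a j else 0.

Definition shift {T : Type} (a : nat -> T) (k : nat) : T := a k.+1.

Definition scons {T : Type} (x : T) (a : nat -> T) (k : nat) : T :=
  if k is k'.+1 then a k' else x.

Lemma char_poly_jac (A : comNzRingType) (n : nat) (a b : nat -> A) :
  char_poly (jac n.+2 a b) =
    ('X - (b 0%N)%:P) * char_poly (jac n.+1 (shift a) (shift b))
    - (a 0%N ^+ 2)%:P * char_poly (jac n (shift (shift a)) (shift (shift b))).
Proof.
rewrite /char_poly det_tridiag.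
- congr (_ * _ - _ * _).
  + by rewrite !mxE.
  + by congr (\det _); apply/matrixP => i j; rewrite !mxE.
  + by rewrite !mxE /= !mulr0n !sub0r mulrNN -polyCM expr2.
  + by congr (\det _); apply/matrixP => i j; rewrite !mxE.
- by move=> [[|[|j]] ?] //= _; rewrite !mxE /= mulr0n sub0r oppr0.
- by move=> [[|[|j]] ?] //= _; rewrite !mxE /= mulr0n sub0r oppr0.
Qed.

Lemma char_poly_jac0 (A : comNzRingType) (a b : nat -> A) :
  char_poly (jac 0 a b) = 1.
Proof. exact: det_mx00. Qed.

Lemma char_poly_jac1 (A : comNzRingType) (a b : nat -> A) :
  char_poly (jac 1 a b) = 'X - (b 0%N)%:P.
Proof. by rewrite /char_poly det_mx11 !mxE eqxx mulr1n. Qed.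

(** The characteristic polynomial is affine in the corner entry. With [d] equal to i g this
    separates the real matrix from its imaginary corner. *)
Lemma char_poly_jac_scons (A : comNzRingType) (n : nat) (a b : nat -> A) (x d : A) :
  char_poly (jac n.+1 a (scons (x + d) b)) =
    char_poly (jac n.+1 a (scons x b)) - d%:P * char_poly (jac n (shift a) b).
Proof.
case: n => [|n]; first by rewrite !char_poly_jac1 char_poly_jac0 /= polyCD; ring.
rewrite !char_poly_jac /= polyCD.
set p := char_poly (jac n.+1 (shift a) b); set q := char_poly (jac n _ (shift b)).
rewrite -/p -/q; ring.
Qed.

Lemma coef_char_poly_jac (A : comNzRingType) (n : nat) (a b : nat -> A) :
  (char_poly (jac n a b))`_n = 1.
Proof.
by have /monicP := char_poly_monic (jac n a b); rewrite /lead_coef size_char_poly.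
Qed.

(** Uniqueness in Euclid's algorithm: each division step fixes b_1, then a_1^2 because the remainder
    is a multiple of a monic polynomial, then a_1 by positivity. *)
Lemma jac_inj (C : numDomainType) (n : nat) (a a' b b' : nat -> C) :
    (forall i, 0 < a i) -> (forall i, 0 < a' i) ->
    char_poly (jac n.+1 a b) = char_poly (jac n.+1 a' b') ->
    char_poly (jac n (shift a) (shift b)) = char_poly (jac n (shift a') (shift b')) ->
  jac n.+1 a b = jac n.+1 a' b'.
Proof.
move=> a0 a'0 e1 e2.
suff [ea eb] : (forall i, (i < n)%N -> a i = a' i) /\ (forall i, (i <= n)%N -> b i = b' i).
  apply/matrixP => i j; rewrite !mxE; have := ltn_ord i; have := ltn_ord j.
  case: eqP => // _; first by move=> _; rewrite ltnS => /eb.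
  case: eqP => [-> | _]; first by rewrite ltnS => /ea.
  by case: eqP => [-> | _] //; rewrite ltnS => _ /ea.
elim: n a a' b b' a0 a'0 e1 e2 => [|n IH] a a' b b' a0 a'0.
  rewrite !char_poly_jac1 => /addrI/oppr_inj/polyC_inj e _.
  by split=> [] [].
rewrite !char_poly_jac => + e2; rewrite e2.
set q := char_poly (jac _ (shift a') _).
set r := char_poly _; set r' := char_poly _ => e.
have e3 : (b' 0%N - b 0%N)%:P * q = (a 0%N ^+ 2)%:P * r - (a' 0%N ^+ 2)%:P * r'.
  rewrite polyCB; apply/eqP; rewrite -subr_eq0; apply/eqP.
  move/eqP: e; rewrite -subr_eq0 => /eqP; set u := LHS => eu.
  by rewrite -[RHS]eu /u; ring.
(* Compare coefficients of degree n+1: [q] is monic of that degree, while [r] and [r'] have degree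
   n. *)
have eb : b 0%N = b' 0%N.
  have := congr1 (coefp n.+1) e3; rewrite /= coefB !coefCM coef_char_poly_jac mulr1.
  rewrite !nth_default ?size_char_poly // !mulr0 subrr => /eqP.
  by rewrite subr_eq0 => /eqP.
have e4 : (a 0%N ^+ 2)%:P * r = (a' 0%N ^+ 2)%:P * r'.
  by apply/eqP; rewrite -subr_eq0 -e3 eb subrr polyC0 mul0r.
have ea : a 0%N = a' 0%N.
  have := congr1 (coefp n) e4; rewrite /= !coefCM !coef_char_poly_jac !mulr1.
  by move/eqP; rewrite eqrXn2 ?ltW // => /eqP.
have er : r = r'.
  by move: e4; rewrite ea; apply: mulfI; rewrite polyC_eq0 expf_eq0 /= gt_eqF.
have [IHa IHb] := IH _ _ _ _ (fun=> a0 _) (fun=> a'0 _) e2 er.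
by split=> [] [|i] // /ltnSE ?; [apply: IHa | apply: IHb].
Qed.

(** * Linear functionals on polynomials *)

Definition pairing {A : nzRingType} (n : nat) (v : nat -> A) (K : {poly A}) : A :=
  \sum_(i < n) K`_i * v i.

Section Pairing.
Variable A : comNzRingType.
Implicit Types (n : nat) (v : nat -> A) (K L : {poly A}).

Lemma pairingD n v K L : pairing n v (K + L) = pairing n v K + pairing n v L.
Proof. by rewrite /pairing -big_split; apply: eq_bigr => i _; rewrite coefD mulrDl. Qed.

Lemma pairingCM n v c K : pairing n v (c%:P * K) = c * pairing n v K.
Proof. by rewrite /pairing mulr_sumr; apply: eq_bigr => i _; rewrite coefCM mulrA. Qed.

Lemma eq_pairing n v w K :
  (forall i, (i < n)%N -> v i = w i) -> pairing n v K = pairing n w K.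
Proof. by move=> e; apply: eq_bigr => i _; rewrite e. Qed.

Lemma pairing_widen n v K : (size K <= n)%N -> pairing n.+1 v K = pairing n v K.
Proof. by move=> sK; rewrite /pairing big_ord_recr /= nth_default // mul0r addr0. Qed.

(** Multiplication by 'X - c is adjoint to the operator S - c on sequences, S being the left
    shift. *)
Lemma pairingMXsubC n v c K : (size K <= n)%N ->
  pairing n.+1 v (K * ('X - c%:P)) = pairing n (fun i => v i.+1 - c * v i) K.
Proof.
move=> sK; rewrite mulrBr [K * c%:P]mulrC -mulNr -polyCN pairingD pairingCM.
rewrite (pairing_widen _ sK) {1}/pairing big_ord_recl coefMX /= mul0r add0r.
rewrite /pairing mulr_sumr -big_split /=; apply: eq_bigr => i _.
by rewrite coefMX /=; ring.
Qed.

(** Geometric sequences, the kernel of S - x, act as multiples of evaluation at x. *)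
Lemma pairing_geometric n c x K : (size K <= n)%N ->
  pairing n (fun i => c * x ^+ i) K = c * K.[x].
Proof.
move=> sK; rewrite (horner_coef_wide _ sK) mulr_sumr.
by apply: eq_bigr => i _; rewrite mulrCA.
Qed.

Lemma pairing_delta n m K : (m < n)%N ->
  pairing n (fun i => (i == m)%:R) K = K`_m.
Proof.
move=> mn; rewrite /pairing (bigD1 (Ordinal mn)) //= eqxx mulr1 big1 ?addr0 //.
by move=> i /negPf ne; rewrite (_ : (i == m :> nat) = false) ?mulr0 //.
Qed.

End Pairing.

Notation conjp := (map_poly Num.conj).

(** * Hermitian forms given by polynomials in two variables *)

Section Hermite.
Variable C : numClosedFieldType.
Implicit Types (n : nat) (v : nat -> C) (p q r s P Q : {poly C}) (H : {poly {poly C}}).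

(* A polynomial in two variables is an element of [{poly {poly C}}]: ['X] is
   the first variable, ['X%:P] the second one, and [p^:P], [p%:P] are [p]
   in the first and in the second variable. *)
Definition hform n H v : C :=
  pairing n (fun i => (v i)^*) (pairing n (fun i => (v i)%:P) H).

(** In [C] the inequality also asserts that the value is real; the index [i] witnesses that the
    first [n] entries of [v] are not all zero. *)
Definition posdef n H : Prop :=
  forall v i, (i < n)%N -> v i != 0 -> 0 < hform n H v.

(** Degree below [n] in each variable, so that [hform n] sees every coefficient of [H]. *)
Definition bounded n H : Prop :=
  (size H <= n)%N /\ forall i, (size (H`_i)%R <= n)%N.

Lemma hformD n H K v : hform n (H + K) v = hform n H v + hform n K v.
Proof. by rewrite /hform !pairingD. Qed.

Lemma hformCM n c H v : hform n (c%:P%:P * H) v = c * hform n H v.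
Proof. by rewrite /hform !pairingCM. Qed.

Lemma conj_pairing n v p :
  (pairing n v p)^* = pairing n (fun i => (v i)^*) (conjp p).
Proof.
by rewrite rmorph_sum; apply: eq_bigr => i _; rewrite rmorphM coef_map.
Qed.

(** A product p(x) conjp p(y) is a form of rank one: the squared modulus of a functional. *)
Lemma hform_square n p v :
  hform n (p^:P * (conjp p)%:P) v = pairing n v p * (pairing n v p)^*.
Proof.
rewrite /hform mulrC pairingCM conj_pairing.
rewrite (_ : pairing n (fun i => (v i)%:P) p^:P = (pairing n v p)%:P).
  by rewrite mulrC pairingCM.
by rewrite rmorph_sum; apply: eq_bigr => i _; rewrite coef_map -polyCM.
Qed.

Lemma size_pairing n H v : bounded n H ->
  (size (pairing n (fun i => (v i)%:P) H) <= n)%N.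
Proof.
case=> _ sH; apply: (leq_trans (size_sum _ _ _)); apply/bigmax_leqP => i _.
by rewrite mulrC mul_polyC (leq_trans (size_scale_leq _ _)).
Qed.

Lemma hform_widen n H v : bounded n H -> hform n.+1 H v = hform n H v.
Proof.
move=> bH; rewrite /hform pairing_widen; last first.
  by rewrite pairing_widen ?size_pairing //; case: bH.
by rewrite pairing_widen //; case: bH.
Qed.

Lemma eq_hform n H v w : (forall i, (i < n)%N -> v i = w i) ->
  hform n H v = hform n H w.
Proof.
move=> e; rewrite /hform (eq_pairing (w := fun i => (w i)^*)); last first.
  by move=> i /e ->.
by congr pairing; apply: eq_pairing => i /e ->.
Qed.

(** Congruence by S - conj z. The second variable is paired with conj v, which is why its factor
    carries z instead. *)
Lemma hform_shift n z H v : bounded n H ->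
  hform n.+1 (H * ('X - (z^*)%:P%:P) * ('X - z%:P)%:P) v =
    hform n H (fun i => v i.+1 - z^* * v i).
Proof.
move=> bH; rewrite /hform [_ * (_)%:P]mulrC pairingCM pairingMXsubC; last by case: bH.
rewrite mulrC pairingMXsubC.
  rewrite (eq_pairing (w := fun i => (v i.+1 - z^* * v i)^*)); last first.
    by move=> i _; rewrite rmorphB rmorphM /= conjCK.
  by congr pairing; apply: eq_pairing => i _; rewrite polyCB polyCM.
rewrite (eq_pairing (w := fun i => (v i.+1 - z^* * v i)%:P)) ?size_pairing //.
by move=> i _; rewrite polyCB polyCM.
Qed.

Lemma boundedP n H : (forall i j, (n <= i)%N || (n <= j)%N -> H`_i`_j = 0) -> bounded n H.
Proof.
move=> b; split=> [|i]; apply/leq_sizeP => j nj; last by rewrite b ?nj ?orbT.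
by apply/polyP => k; rewrite coef0 b ?nj.
Qed.

Lemma boundedE n H i j : bounded n H -> (n <= i)%N || (n <= j)%N -> H`_i`_j = 0.
Proof.
case=> sH sHi /orP[] ?; last by rewrite nth_default // (leq_trans (sHi i)).
by rewrite (nth_default _ (leq_trans sH _)) // coef0.
Qed.

(** This is 1 / (2i). *)
Local Notation kappa := (- 'i / 2 : C).

Lemma Im_kappa z : 'Im z = kappa * (z - z^*).
Proof. by rewrite ImE; ring. Qed.

Lemma conjpK : involutive (map_poly (@Num.conj C)).
Proof. by move=> p; apply/polyP => i; rewrite !coef_map /= conjCK. Qed.

Lemma bounded_shift n z w H : bounded n H ->
  bounded n.+1 (H * ('X - z%:P%:P) * ('X - w%:P)%:P).
Proof.
move=> bH; apply: boundedP => i j ij; rewrite coefMC.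
have coef_shift (A : comNzRingType) (K : {poly A}) c k :
    (K * ('X - c%:P))`_k = (if k is k'.+1 then K`_k' else 0) - K`_k * c.
  by rewrite mulrBr coefB coefMX coefMC; case: k.
rewrite coef_shift coef_shift; case: i ij => [|i] ij; case: j ij => [|j] ij //=.
all: rewrite ?coefB ?coefMC ?coef0 ?(boundedE bH); rewrite ?subrr ?mul0r ?subr0 ?mul0r ?subrr //; lia.
Qed.

(** * Positivity of the Hermite form *)

(** Induction on the roots. Adding a root z to p replaces H by (x - conj z) (y - z) H + Im z p(x)
    conjp p(y), because (x - z) (y - conj z) - (x - conj z) (y - z) = (x - y) (z - conj z). *)
Lemma hermite_form (zs : seq C) : (forall z, z \in zs -> 0 < 'Im z) ->
  let p := \prod_(z <- zs) ('X - z%:P) in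
  exists H, [/\ bounded (size zs) H, posdef (size zs) H &
    ('X - 'X%:P) * H =
      kappa%:P%:P * (p^:P * (conjp p)%:P - (conjp p)^:P * p%:P)].
Proof.
elim: zs => [_ p|z zs IH zs0 p] /=.
  exists 0; split=> //.
    by apply: boundedP => i j _; rewrite !coef0.
  by rewrite /p big_nil !rmorph1 subrr !mulr0.
have z0 : 0 < 'Im z by apply: zs0; rewrite mem_head.
have {IH} [|H [bH H0 eH]] := IH; first by move=> w wzs; rewrite zs0 // inE wzs orbT.
have {p} -> : p = (\prod_(w <- zs) ('X - w%:P)) * ('X - z%:P).
  by rewrite /p big_cons mulrC.
set p := \prod_(w <- zs) _ in eH *.
exists (H * ('X - (z^*)%:P%:P) * ('X - z%:P)%:P
   + ('Im z)%:P%:P * (p^:P * (conjp p)%:P)); split.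
- apply: boundedP => i j ij; rewrite !coefD (boundedE (bounded_shift z^* z bH)) //.
  rewrite add0r coefCM coefCM coefMC coef_map coefCM coef_map /=.
  have szp k : (size zs < k)%N -> p`_k = 0 by move=> ?; rewrite nth_default // size_prod_XsubC.
  by case/orP: ij => /szp ->; rewrite ?rmorph0 ?mul0r ?mulr0.
- move=> v i izs vi; rewrite hformD hformCM hform_shift // hform_square.
  set u := fun k => v k.+1 - z^* * v k.
  (* If [u] is nonzero, the first summand is already positive and the square is nonnegative. *)
  have [/existsP[k uk]|] := boolP [exists k : 'I_(size zs), u k != 0].
    by rewrite ltr_pwDl ?(H0 _ k) // mulr_ge0 ?mul_conjC_ge0 // ltW.
  rewrite negb_exists => /forallP u0.
  (* Otherwise [v] is geometric with ratio conj z, so the square is the squared modulus of v_0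
     p(conj z). This is nonzero: conj z lies in the lower half plane, the roots of p in the upper
     one. *)
  have vE k : (k <= size zs)%N -> v k = v 0%N * z^* ^+ k.
    elim: k => [|k IHk] kzs; first by rewrite expr0 mulr1.
    have := u0 (Ordinal kzs); rewrite negbK subr_eq0 => /eqP /= ->.
    by rewrite IHk ?(ltnW kzs) // exprS mulrCA.
  have v0 : v 0%N != 0 by apply: contraNneq vi => v0; rewrite vE // v0 mul0r.
  have pz : p.[z^*] != 0.
    rewrite -/(root p _) root_prod_XsubC; apply/negP => zzs.
    by have := zs0 z^*; rewrite inE zzs orbT => /(_ isT); rewrite Im_conj oppr_gt0 lt_gtF.
  rewrite (eq_hform _ (w := fun=> 0)) => [|k kzs]; last first.
    by have := u0 (Ordinal kzs); rewrite negbK => /eqP.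
  rewrite [X in X + _]big1 ?add0r => [|k _]; last by rewrite conjC0 mulr0.
  rewrite mulr_gt0 ?mul_conjC_gt0 //.
  rewrite (eq_pairing _ (w := fun k => v 0%N * z^* ^+ k)) => [|k]; last exact: vE.
  by rewrite pairing_geometric ?size_prod_XsubC // mulf_neq0.
- rewrite mulrDr [RHS]/=.
  rewrite !(rmorphM, rmorphB) /= !map_polyX !map_polyC /= Im_kappa.
  rewrite [LHS](_ : _ = ('X - (z^*)%:P%:P) * ('X - z%:P)%:P * (('X - 'X%:P) * H)
    + kappa%:P%:P * (z - z^*)%:P%:P * ('X - 'X%:P) * (p^:P * (conjp p)%:P)).
    by rewrite eH; ring.
  by rewrite polyCM; ring.
Qed.

(** * Bezoutians and Euclid's algorithm *)

(** [H] is the Bezoutian, specified through its product with x - y to avoid division in two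
    variables. *)
Definition bezout n P q : Prop :=
  exists H, [/\ bounded n H, posdef n H &
    ('X - 'X%:P) * H = P^:P * q%:P - q^:P * P%:P].

(** The invariant of Euclid's algorithm, in degrees n+1 and n; [jacobi_pair_jac] realises such pairs
    by real Jacobi matrices. *)
Definition jacobi_pair n P q : Prop :=
  [/\ P \is monic, size P = n.+2, q \is monic & size q = n.+1]
  /\ [/\ conjp P = P, conjp q = q & bezout n.+1 P q].

Lemma hform_delta n m H : (m < n)%N ->
  hform n H (fun i => (i == m)%:R) = H`_m`_m.
Proof.
move=> mn; rewrite /hform (eq_pairing (w := fun i => (i == m)%:R)); last first.
  by move=> i _; rewrite conjC_nat.
rewrite pairing_delta // (eq_pairing (w := fun i => (i == m)%:R)) ?pairing_delta //.
by move=> i _; case: eqP.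
Qed.

(* The leading coefficient of [s] is the last diagonal entry of the Bezoutian. *)
Lemma jacobi_pair_normalize n P s :
    P \is monic -> size P = n.+2 -> s`_n.+1 = 0 -> conjp P = P -> conjp s = s ->
    bezout n.+1 P s ->
  exists c q, [/\ 0 < c, s = c%:P * q & jacobi_pair n P q].
Proof.
move=> mP sP s0 rP rs [H [bH pH eH]].
have Pn : P`_n.+1 = 1 by have /monicP := mP; rewrite /lead_coef sP.
(* Coefficient of x^(n+1) in [eH], where [H] has degree at most n in x. *)
have sE : s = H`_n.
  have := congr1 (coefp n.+1) eH; rewrite /= mulrBl !coefB coefXM !coefCM !coefMC !coef_map /=.
  rewrite Pn s0 [H`_n.+1]nth_default ?mul0r ?mulr0 ?mul1r ?subr0 //; by case: bH.
set c := s`_n; have c0 : 0 < c.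
  rewrite /c sE -(hform_delta (n := n.+1)) //; apply: (pH _ n) => //.
  by rewrite eqxx oner_eq0.
have cU : c \is a GRing.unit by rewrite unitfE gt_eqF.
have cR : c^* = c by rewrite conj_Creal // gtr0_real.
have sq : s = c%:P * (c^-1%:P * s) by rewrite mulrA -polyCM divrr // mul1r.
exists c, (c^-1%:P * s); split => //.
have qn : (c^-1%:P * s)`_n = 1 by rewrite coefCM mulVr.
have size_q : size (c^-1%:P * s) = n.+1.
  apply/eqP; rewrite eqn_leq; apply/andP; split.
    by rewrite mul_polyC (leq_trans (size_scale_leq _ _)) // sE; case: bH.
  by rewrite ltnNge; apply/negP => /leq_sizeP/(_ n (leqnn n))/eqP; rewrite qn oner_eq0.
split; split=> //; first by rewrite monicE /lead_coef size_q qn.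
  by rewrite rmorphM /= map_polyC /= rs fmorphV /= cR.
exists (c^-1%:P%:P * H); split.
- by apply: boundedP => i j ij; rewrite !coefCM (boundedE bH) ?mulr0.
- by move=> v i ni vi; rewrite hformCM mulr_gt0 ?invr_gt0 ?(pH v i).
- rewrite mulrCA eH !rmorphM /= map_polyC /=; ring.
Qed.

Lemma jacobi_pair_step n P q : jacobi_pair n.+1 P q ->
  exists b c r, [/\ b \is Num.real, 0 < c, P = ('X - b%:P) * q - c%:P * r &
    jacobi_pair n q r].
Proof.
move=> [[mP sP mq sq] [rP rq [H [bH pH eH]]]].
have Pn : P`_n.+2 = 1 by have /monicP := mP; rewrite /lead_coef sP.
have qn : q`_n.+1 = 1 by have /monicP := mq; rewrite /lead_coef sq.
have qn2 : q`_n.+2 = 0 by rewrite nth_default // sq.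
have coefR p k : conjp p = p -> p`_k \is Num.real.
  by move=> rp; rewrite CrealE -coef_map rp.
(* The value that cancels the coefficient of degree n+1 in [s]. *)
pose b := q`_n - P`_n.+1.
have bR : b \is Num.real by rewrite rpredB ?coefR.
pose s := ('X - b%:P) * q - P.
pose B := H - q^:P * q%:P.
have eB : ('X - 'X%:P) * B = q^:P * s%:P - s^:P * q%:P.
  rewrite /B /s mulrBr eH !(rmorphM, rmorphB) /= !map_polyX !map_polyC /=; ring.
(* The last row and column of [H] agree with those of q(x) q(y), so [B] loses one degree in each
   variable. *)
have Hn : H`_n.+1 = q.
  have := congr1 (coefp n.+2) eH; rewrite /= mulrBl !coefB coefXM !coefCM !coefMC !coef_map /=.
  rewrite Pn qn2 [H`_n.+2]nth_default ?mul0r ?mulr0 ?mul1r ?subr0 //; by case: bH.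
have Hin i : H`_i`_n.+1 = q`_i.
  have := congr1 (coefp n.+2) (congr1 (coefp i) eH).
  rewrite /= mulrBl !coefB coefXM !coefCM !coefMC !coef_map /= !coefCM coefXM.
  rewrite Pn qn2 mulr0 mulr1 sub0r /= => /(congr1 -%R); rewrite opprK opprB => <-.
  by case: (i == 0%N); rewrite ?coef0 ?(boundedE (j := n.+2) bH) ?leqnn ?orbT ?subr0.
have bB : bounded n.+1 B.
  apply: boundedP => i j ij; rewrite !coefB coefMC coef_map coefCM /=.
  case: (ltngtP i n.+1) ij => [_|ni|->] /= ij.
  - case: (ltngtP j n.+1) ij => [//|nj|->] _; last by rewrite Hin qn mulr1 subrr.
    by rewrite (boundedE bH) ?nj ?orbT // [q`_j]nth_default ?mulr0 ?subrr ?sq.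
  - by rewrite (boundedE bH) ?ni // [q`_i]nth_default ?mul0r ?subrr ?sq.
  - by rewrite Hn qn mul1r subrr.
have pB : posdef n.+1 B.
  move=> v i ni vi.
  (* Since [q] is monic of degree n+1, one further entry extends [v] to a vector annihilated by [q];
     there the square vanishes and [H] agrees with [B]. *)
  pose w k := if (k < n.+1)%N then v k else - pairing n.+1 v q.
  have vw k : (k < n.+1)%N -> v k = w k by rewrite /w => ->.
  have w0 : pairing n.+2 w q = 0.
    rewrite /pairing big_ord_recr /= qn mul1r {2}/w ltnn.
    by rewrite -[X in X - _]/(pairing n.+1 w q) (eq_pairing _ vw) subrr.
  have := pH w i (ltnW ni); rewrite -vw // => /(_ vi).
  rewrite (_ : H = B + q^:P * (conjp q)%:P); last by rewrite rq /B subrK.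
  rewrite hformD hform_square w0 mul0r addr0 hform_widen //.
  by rewrite (eq_hform _ (w := w)).
have s0 : s`_n.+1 = 0 by rewrite /s mulrBl !coefB coefXM coefCM qn mulr1 /= /b; ring.
have rs : conjp s = s.
  by rewrite /s rmorphB rmorphM rmorphB /= map_polyX map_polyC /= rP rq conj_Creal.
have [|c [r [c0 es jqr]]] := jacobi_pair_normalize mq sq s0 rq rs; first by exists B.
exists b, c, r; split=> //.
by rewrite -es /s; ring.
Qed.

Lemma jacobi_pair_jac n P q : jacobi_pair n P q ->
  exists a b : nat -> C, [/\ forall i, 0 < a i, forall i, b i \is Num.real,
    P = char_poly (jac n.+1 a b) & q = char_poly (jac n (shift a) (shift b))].
Proof.
elim: n P q => [|n IH] P q.
  move=> [[mP sP mq sq] [rP rq _]].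
  (* A monic [P] of degree 1 is 'X + P_0; 1 is an arbitrary positive value. *)
  exists (fun=> 1), (fun=> - P`_0); split=> //.
  - move=> _; by rewrite rpredN CrealE -coef_map rP.
  - rewrite char_poly_jac1; apply/polyP => -[|[|i]]; rewrite coefB coefX coefC /=.
    + by rewrite sub0r opprK.
    + by have /monicP := mP; rewrite /lead_coef sP subr0.
    + by rewrite nth_default ?sP ?subrr.
  - have /monicP := mq; rewrite char_poly_jac0 /lead_coef sq /= => q0.
    by rewrite [q]size1_polyC ?sq // q0.
move=> /jacobi_pair_step[b0 [c [r [b0R c0 -> /IH[a [b [a0 bR eq er]]]]]]].
exists (scons (sqrtC c) a), (scons b0 b); split.
- by case=> //=; rewrite sqrtC_gt0.
- by case.
- by rewrite char_poly_jac /= sqrtCK eq er.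
- by rewrite eq.
Qed.

(** * Existence over a closed field *)

Lemma jac_exists (zs : seq C) : (0 < size zs)%N ->
    (forall z, z \in zs -> 0 < 'Im z) ->
  exists (a b : nat -> C) (g : C), [/\ 0 < g, forall i, 0 < a i,
    forall i, b i \is Num.real &
    char_poly (jac (size zs) a (scons (b 0%N + 'i * g) (shift b))) =
      \prod_(z <- zs) ('X - z%:P)].
Proof.
case en : (size zs) => [//|n] _ /hermite_form /=.
set p := \prod_(z <- zs) _; rewrite en => -[H [bH pH eH]].
have sp : size p = n.+2 by rewrite size_prod_XsubC en.
have pn : p`_n.+1 = 1.
  by have /monicP := monic_prod_XsubC zs predT id; rewrite /lead_coef -/p sp.
(* Split p = P - i s with real coefficients in [P] and [s]; the leading terms cancel in [s], which
   will be g q. *)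
pose P := 2^-1%:P * (p + conjp p); pose s := kappa%:P * (conjp p - p).
have Pn : P`_n.+1 = 1.
  by rewrite coefCM coefD coef_map /= pn conjC1 mulVf // pnatr_eq0.
have sP : size P = n.+2.
  apply/eqP; rewrite eqn_leq; apply/andP; split.
    rewrite /P mul_polyC (leq_trans (size_scale_leq _ _)) //.
    by rewrite (leq_trans (size_polyD _ _)) // size_map_poly sp maxnn.
  by rewrite ltnNge; apply/negP => /leq_sizeP/(_ _ (leqnn _))/eqP; rewrite Pn oner_eq0.
have mP : P \is monic by rewrite monicE /lead_coef sP Pn.
have s0 : s`_n.+1 = 0 by rewrite coefCM coefB coef_map /= pn conjC1 subrr mulr0.
have rP : conjp P = P.
  by rewrite rmorphM rmorphD /= conjpK map_polyC /= fmorphV /= conjC_nat addrC.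
have rs : conjp s = s.
  rewrite rmorphM rmorphB /= conjpK map_polyC /= (_ : kappa^* = - kappa).
    by rewrite /s polyCN; ring.
  by rewrite fmorph_div /= conjC_nat rmorphN /= conjCi !mulNr.
have [|c [q [c0 es jPq]]] := jacobi_pair_normalize mP sP s0 rP rs.
  (* Expanding P(x) s(y) - s(x) P(y) leaves exactly the Hermite form of p. *)
  exists H; split=> //; rewrite eH /P /s !(rmorphM, rmorphB, rmorphD) /= !map_polyC /=.
  have h2 : (2^-1)%:P%:P * 2 = 1 :> {poly {poly C}}.
    by rewrite -2!polyC_natr -!polyCM mulVf ?pnatr_eq0.
  rewrite -[X in X * (_ - _) = _]mulr1 -h2; ring.
have [a [b [a0 bR eP eq]]] := jacobi_pair_jac jPq.
exists a, b, c; split=> //.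
rewrite char_poly_jac_scons -eq (_ : char_poly _ = P); last first.
  rewrite eP; congr char_poly; apply/matrixP => i j; rewrite !mxE.
  by case: (i : nat).
rewrite polyCM -mulrA -es /P /s.
rewrite !mulrA -polyCM (_ : 'i * kappa = 2^-1).
  have h2 : (2^-1)%:P * 2 = 1 :> {poly C}.
    by rewrite -polyC_natr -polyCM mulVf ?pnatr_eq0.
  by rewrite -[RHS]mul1r -h2; ring.
by rewrite mulrA mulrN mulCii opprK mul1r.
Qed.

(** * Uniqueness over a closed field *)

Lemma jac_perturb n (a b : nat -> C) (d : C) :
  jac n.+1 a (scons (b 0%N + d) (shift b)) = jac n.+1 a b + d *: delta_mx 0 0.
Proof.
apply/matrixP => i j; rewrite !mxE.
case: (eqVneq j i) => [->|ji].
  rewrite andbb; case: (unliftP 0 i) => [k ->|->] /=; first by rewrite mulr0 addr0.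
  by rewrite mulr1.
have -> : (i == 0) && (j == 0) = false; last by rewrite mulr0 addr0.
by apply/negP => /andP[/eqP i0 /eqP j0]; rewrite i0 j0 eqxx in ji.
Qed.

Lemma conjp_char_poly_jac n (a b : nat -> C) :
    (forall i, 0 < a i) -> (forall i, b i \is Num.real) ->
  conjp (char_poly (jac n a b)) = char_poly (jac n a b).
Proof.
move=> a0 bR; rewrite map_char_poly; congr char_poly.
apply/matrixP => i j; rewrite !mxE.
have aC k : (a k)^* = a k by rewrite conj_Creal // gtr0_real.
by case: ifP => _; [exact: conj_Creal | do 2?case: ifP => _; rewrite /= ?aC ?conjC0].
Qed.

Lemma jac_unique n (a a' b b' : nat -> C) (g g' : C) :
    0 < g -> (forall i, 0 < a i) -> (forall i, b i \is Num.real) ->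
    0 < g' -> (forall i, 0 < a' i) -> (forall i, b' i \is Num.real) ->
    char_poly (jac n.+1 a (scons (b 0%N + 'i * g) (shift b))) =
    char_poly (jac n.+1 a' (scons (b' 0%N + 'i * g') (shift b'))) ->
  jac n.+1 a (scons (b 0%N + 'i * g) (shift b)) =
  jac n.+1 a' (scons (b' 0%N + 'i * g') (shift b')).
Proof.
move=> g0 a0 bR g'0 a'0 b'R; rewrite !char_poly_jac_scons !jac_perturb.
have scons_shift (c : nat -> C) : jac n.+1 ^~ (scons (c 0%N) (shift c)) =1 jac n.+1 ^~ c.
  by move=> d; apply/matrixP => i j; rewrite !mxE; case: (i : nat).
rewrite !scons_shift; set P := char_poly _; set P' := char_poly (jac n.+1 a' b').
set q := char_poly _; set q' := char_poly (jac n _ (shift b')) => e.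
(* Conjugate [e]: the real polynomials stay fixed and i changes sign. Adding the two equations
   isolates [P], and then g q. *)
have e2 : P + ('i * g)%:P * q = P' + ('i * g')%:P * q'.
  have := congr1 (map_poly Num.conj) e; rewrite !rmorphB !rmorphM /= !map_polyC /=.
  rewrite /P /P' /q /q' !conjp_char_poly_jac //; try by move=> i; rewrite /shift.
  by rewrite conjCi !(conj_Creal (gtr0_real _)) // polyCN !mulNr !opprK.
have PP : P = P'.
  have := congr2 +%R e e2; rewrite !(addrACA _ (- _)) !addNr !addr0 => E.
  have : 2%:P * P = 2%:P * P' by rewrite polyC_natr !mulr_natl !mulr2n.
  by apply: mulfI; rewrite polyC_eq0 pnatr_eq0.
have gq : g%:P * q = g'%:P * q'.
  move: e2; rewrite PP => /addrI; rewrite !polyCM -!mulrA; apply: mulfI.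
  by rewrite polyC_eq0 neq0Ci.
(* Both [q] and [q'] are monic of degree n, so g is the leading coefficient of g q. *)
have gg : g = g'.
  by have := congr1 (coefp n) gq; rewrite /= !coefCM !coef_char_poly_jac !mulr1.
have qq : q = q' by move: gq; rewrite gg; apply: mulfI; rewrite polyC_eq0 gt_eqF.
by rewrite gg (jac_inj a0 a'0 PP qq).
Qed.

End Hermite.

(** * Algebraic multiplicities and the characteristic polynomial *)

Lemma eq_prod_XsubC (F : fieldType) (s t : seq F) :
  (forall x, count_mem x s = count_mem x t) ->
  \prod_(z <- s) ('X - z%:P) = \prod_(z <- t) ('X - z%:P).
Proof.
move=> st; apply: perm_big; rewrite /perm_eq; apply/allP => x _ /=.
by rewrite st.
Qed.

(** Over a closed field the characteristic polynomial splits, so its root multiplicities determine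
    it. *)
Lemma alg_multP (F : closedFieldType) (n : nat) (J : 'M[F]_n) (z : 'I_n -> F) :
  (forall x, alg_mult J x = #|[set k : 'I_n | z k == x]|) <->
  char_poly J = \prod_(x <- [seq z k | k : 'I_n]) ('X - x%:P).
Proof.
have countE x : #|[set k : 'I_n | z k == x]| = count_mem x [seq z k | k : 'I_n].
  by rewrite cardsE cardE size_filter count_map enumT; apply: eq_count => k.
split=> [e|e x]; last by rewrite /alg_mult e mu_prod_XsubC countE.
have [s es] := closed_field_poly_normal (char_poly J).
have /monicP lc := char_poly_monic J; rewrite lc scale1r in es.
rewrite es; apply: eq_prod_XsubC => x.
by rewrite -countE -e /alg_mult es mu_prod_XsubC.
Qed.

(** * Jacobi matrices over [R[i]] with prescribed eigenvalues *)

Section Complex.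
Variable R : realType.
Local Notation C := R[i].

(** The bridge between ['Im], valued in [C], and [complex.Im], valued in [R]. *)
Lemma Im_complex (x : C) : 'Im x = real_complex _ (complex.Im x).
Proof. by rewrite ImJ_sub ImE ['i * _]mulrC mulrAC. Qed.

Lemma jacobi_form_jac n (a b : nat -> C) (g : C) :
    0 < g -> (forall i, 0 < a i) -> (forall i, b i \is Num.real) ->
  jacobi_form (jac n a (scons (b 0%N + 'i * g) (shift b))).
Proof.
move=> g0 a0 bR.
split=> [i j ij|i j ji|i i0|i i0]; rewrite !mxE.
- by case: (eqVneq j i) ij => [->|_]; [lia | do 2?case: eqP => [->|_] //; lia].
- have ne : (j == i) = false by apply/negP => /eqP e; move: ji; rewrite e; lia.
  rewrite ne [i == j]eq_sym ne ji eqxx (_ : (i == i.+2 :> nat) = false); last lia.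
  by split.
- rewrite eqxx i0 /= -(ltcR 0) -Im_complex.
  by rewrite Im_rect ?bR // gtr0_real.
- rewrite eqxx; case: (i : nat) i0 => // k _ /=; rewrite /shift.
  by have /complex_realP[x ->] := bR k.+1.
Qed.

Lemma jac_jacobi_form n (J : 'M[C]_n.+1) : jacobi_form J ->
  exists (a b : nat -> C) (g : C), [/\ 0 < g, forall i, 0 < a i,
    forall i, b i \is Num.real & J = jac n.+1 a (scons (b 0%N + 'i * g) (shift b))].
Proof.
move=> [J0 Ja Jg Jb].
(* The default 1 keeps [a] positive at every index; [b] takes the real parts of the diagonal, whose
   only imaginary part sits at the corner. *)
exists (fun k => if (k < n)%N then J (inord k) (inord k.+1) else 1),
  (fun k => (complex.Re (J (inord k) (inord k)))%:C%C), (complex.Im (J 0 0))%:C%C; split.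
- by rewrite ltcR Jg.
- move=> k; case: ifP => // kn.
  by have [] := Ja (inord k) (inord k.+1); rewrite ?inordK ?ltnS // ltnW.
- by move=> k; apply/complex_realP; eexists.
- apply/matrixP => i j; rewrite !mxE.
  have inordE (k : 'I_n.+1) (l : nat) : l = k -> inord l = k by move=> ->; rewrite inord_val.
  case: eqVneq => [->|ji].
    rewrite {1}[J i i]complexE; case: (unliftP 0 i) => [k ->|->] /=.
      by rewrite /shift (inordE (lift 0 k)) // Jb // mulr0 addr0.
    by rewrite (inordE 0).
  case: eqP => [ij|ij]; last case: eqP => [ij'|ij'].
  - have ni : (i < n)%N by have := ltn_ord j; lia.
    by rewrite ni -ij !inord_val.
  - have nj : (j < n)%N by have := ltn_ord i; lia.
    by rewrite nj -ij' !inord_val; have [] := Ja j i ij'.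
  - apply: J0; move: ij ij' ji; rewrite -val_eqE /=; lia.
Qed.

End Complex.

Theorem theorem5p1 (R : realType) (n : nat) (hn : (0 < n)%N)
    (z : 'I_n -> R[i]) (hz : forall k : 'I_n, 0 < complex.Im (z k)) :
  exists! J : 'M[R[i]]_n,
    jacobi_form J /\
    forall x : R[i], alg_mult J x = #|[set k : 'I_n | z k == x]|.
Proof.
case: n hn z hz => // n _ z hz.
pose zs := [seq z k | k : 'I_n.+1].
have szs : size zs = n.+1 by rewrite size_map size_enum_ord.
have zs0 x : x \in zs -> 0 < 'Im x.
  by move=> /mapP[k _ ->]; rewrite Im_complex ltcR.
have [|a [b [g [g0 a0 bR ep]]]] := jac_exists _ zs0; first by rewrite szs.
rewrite szs in ep; exists (jac n.+1 a (scons (b 0%N + 'i * g) (shift b))); split.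
  by split; [exact: jacobi_form_jac | exact/alg_multP].
move=> J' [fJ /alg_multP eJ].
have [a' [b' [g' [g'0 a'0 b'R EJ]]]] := jac_jacobi_form fJ.
by rewrite EJ; apply: jac_unique => //; rewrite ep -EJ eJ.
Qed.
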